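(* Let $\mathcal{S}$ be a de Bruijn sequence for strings of length $n$ over an alphabet of size $d$ with comb pattern $P_1$, and let $\mathcal{Q}$ be a quotient string over the same alphabet of size $d$ for strings of length $k$ with comb pattern $P_2$ (alphabet identified with $\mathbb{Z}/d\mathbb{Z}$). Let $\mathcal{B}$ be a block pattern consisting of $n+k-1$ blocks such that the connection graph of $\mathcal{B}$ is a tree, the horizontal projection of $\mathcal{B}$ is $P_1$, and the vertical projection of $\mathcal{B}$ is $P_2$. Then the grid $\mathcal{T}$ produced by $\mathcal{Q}\times\mathcal{S}$ with addition modulo $d$ contains every possible filling of the $n+k-1$ blocks of $\mathcal{B}$ by elements of the $d$-letter alphabet exactly once.
   Context: Alphabet: the elements of the group $\mathcal{G}=\mathbb{Z}/d\mathbb{Z}$. Comb: a comb of order $n$ is a binary sequence $x_0x_1\ldots x_s$ containing exactly $n$ ones; it is also represented by the increasing list $[p_1,\ldots,p_n]$ of the indices of its ones. The window of a cyclic sequence $U=u_0\ldots u_{m-1}$ at position $i$ for the comb $[p_1,\ldots,p_n]$ is the $n$-tuple $(u_{i+p_1},\ldots,u_{i+p_n})$, with subscripts taken modulo $m$. De Bruijn sequence with comb pattern: a cyclic sequence of length $d^n$ over the alphabet such that every $n$-tuple over the alphabet is the comb window at exactly one position. Quotient string with comb pattern: on $\mathcal{G}^k$ put the equivalence relation $x\equiv y$ iff there is $c\in\mathcal{G}$ with $x_i-y_i=c$ for all $i$. A quotient string for strings of length $k$ with a given comb pattern of order $k$ is a cyclic string of length $d^{k-1}$ over the alphabet such that,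 among its comb windows, every equivalence class has exactly one representative appearing, and that representative appears exactly once. Grid (torus) $\mathcal{Q}\times\mathcal{S}$: the array with $|\mathcal{Q}|$ rows and $|\mathcal{S}|$ columns whose entry in row $i$ and column $j$ is $\mathcal{S}_j+\mathcal{Q}_i$, with row indices read modulo $|\mathcal{Q}|$ and column indices read modulo $|\mathcal{S}|$. Block pattern: a selection $\mathcal{B}$ of cells (blocks) in a rectangular array of some dimension $s\times t$ (rows indexed $0,\ldots,s-1$, columns indexed $0,\ldots,t-1$). A filling of $\mathcal{B}$ is a function $f:\mathcal{B}\to\mathcal{G}$; it appears in the grid at position $(i,j)$ if for every block $(u,v)\in\mathcal{B}$ the grid entry in row $i+u$, column $j+v$ equals $f(u,v)$. ''Appears exactly once'' means at exactly one position $(i,j)$ with $i$ modulo $|\mathcal{Q}|$ and $j$ modulo $|\mathcal{S}|$. Projections: the horizontal projection of $\mathcal{B}$ is the binary sequence of length $t$ whose entry $v$ is $1$ iff $\mathcal{B}$ has at least one block in column $v$; the vertical projection is the binary sequence of length $s$ whose entry $u$ is $1$ iff $\mathcal{B}$ has at least one block in row $u$. Connection graph: the undirected graph with one node per block of $\mathcal{B}$, in which each block is joined to its nearest neighboring block of $\mathcal{B}$ (if any) in each of the four directions: nearest to the left and right in the same row, and nearest above and below in the same column (cells between them not in $\mathcal{B}$ are skipped). *)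

(* Defs.v *)
From mathcomp Require Import all_boot all_order all_algebra.

Set Implicit Arguments.
Unset Strict Implicit.
Unset Printing Implicit Defensive.

Import GRing.Theory.
Local Open Scope ring_scope.

(* The group Z/dZ for 0 < d, under addition modulo d. 'Z_d is not used because
   it denotes Z/2Z when d = 1. *)
Notation Zmod d := 'I_d.-1.+1.

Section CyclicSequences.
Variable G : zmodType.
Implicit Types (P : seq bool) (U : seq G).

Definition cyc U (i : nat) : G := nth 0 U (i %% size U)%N.

Definition comb_indices P : seq nat :=
  [seq p <- iota 0 (size P) | nth false P p].

Definition window P U (i : nat) : seq G :=
  [seq cyc U (i + p)%N | p <- comb_indices P].

Definition appears P U (w : seq G) : Prop :=
  exists i : 'I_(size U), window P U i = w.

Definition appears_once P U (w : seq G) : Prop :=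
  exists! i : 'I_(size U), window P U i = w.

Definition quot_equiv k (x y : k.-tuple G) : Prop :=
  exists c : G, forall i : 'I_k, tnth x i - tnth y i = c.

Definition grid (Q S : seq G) (i j : nat) : G := cyc S j + cyc Q i.

End CyclicSequences.

Definition is_comb (n : nat) (P : seq bool) : Prop := count id P = n.

Definition de_bruijn (d n : nat) (P : seq bool) (S : seq (Zmod d)) : Prop :=
  [/\ is_comb n P,
      size S = (d ^ n)%N
    & forall w : n.-tuple (Zmod d), appears_once P S w].

(* The truncated k - 1 matters only for k = 0, where the notion is void. *)
Definition quotient_string (d k : nat) (P : seq bool) (Q : seq (Zmod d)) :
    Prop :=
  [/\ is_comb k P,
      size Q = (d ^ (k - 1))%N
    & forall x : k.-tuple (Zmod d),
        exists2 y : k.-tuple (Zmod d),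
          unique (fun z : k.-tuple (Zmod d) =>
                    quot_equiv x z /\ appears P Q z) y
          & appears_once P Q y].

Section BlockPatterns.
Variables s t : nat.
Implicit Type B : {set 'I_s * 'I_t}.

Definition hproj B : seq bool :=
  [seq [exists u : 'I_s, (u, v) \in B] | v <- enum 'I_t].

Definition vproj B : seq bool :=
  [seq [exists v : 'I_t, (u, v) \in B] | u <- enum 'I_s].

Definition block B : finType := {b : 'I_s * 'I_t | b \in B}.

Definition brow B (b : block B) : nat := (val b).1.
Definition bcol B (b : block B) : nat := (val b).2.

(* c is the nearest block to the right of b; equivalently, b is the nearest
   block to the left of c. *)
Definition next_right B (b c : block B) : bool :=
  [&& brow b == brow c, (bcol b < bcol c)%N
    & ~~ [exists x : block B,
            (brow x == brow b) && (bcol b < bcol x < bcol c)%N]].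

Definition next_below B (b c : block B) : bool :=
  [&& bcol b == bcol c, (brow b < brow c)%N
    & ~~ [exists x : block B,
            (bcol x == bcol b) && (brow b < brow x < brow c)%N]].

Definition connection_graph B : rel (block B) := fun b c =>
  [|| next_right b c, next_right c b, next_below b c | next_below c b].

Definition filling_appears_at (G : zmodType) (Q S : seq G) B
    (f : block B -> G) (i j : nat) : Prop :=
  forall b : block B, grid Q S (i + brow b) (j + bcol b) = f b.

End BlockPatterns.

(* For a symmetric irreflexive e: nonempty, connected, and without simple
   cycles. A ucycle of size 2 is just an edge traversed back and forth. *)
Definition is_tree (T : finType) (e : rel T) : Prop :=
  [/\ (0 < #|T|)%N,
      forall x y : T, connect e x y
    & forall c : seq T, ucycle e c -> (size c <= 2)%N].

(* Main.v *)
Require Import Defs.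
From mathcomp Require Import all_boot all_order all_algebra.

(** There are [d ^ (k - 1) * d ^ n] positions and [d ^ (n + k - 1)] fillings, so
    it suffices that distinct positions show distinct fillings. If two positions
    show the same filling, then on every block the change of the column entry is
    the opposite of the change of the row entry. The former is constant along
    columns and the latter along rows, so by connectedness both are constant.
    The two windows of [Q] are then equivalent, hence at the same position; so
    the constant is 0, and the two windows of [S] agree as well. *)

Set Implicit Arguments.
Unset Strict Implicit.
Unset Printing Implicit Defensive.

Import GRing.Theory.
Local Open Scope ring_scope.

Lemma size_comb_indices (P : seq bool) : size (comb_indices P) = count id P.
Proof.
rewrite size_filter -[in RHS](mkseq_nth false P) /mkseq count_map.
exact: eq_count.
Qed.

Lemma size_window (G : zmodType) (P : seq bool) (U : seq G) (i n : nat) :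
  is_comb n P -> size (window P U i) == n.
Proof. by move=> <-; rewrite size_map size_comb_indices. Qed.

(** The window at [j] is itself an [n]-tuple, and the de Bruijn property allows that tuple a single
    position. *)
Lemma de_bruijn_window_inj (d n : nat) (P : seq bool) (S : seq (Zmod d)) :
  de_bruijn n P S -> injective (fun j : 'I_(size S) => window P S j).
Proof.
move=> [combP _ oncePS] j j' /= eq_w.
have [l [_ l_uniq]] := oncePS (Tuple (size_window S j combP)).
by rewrite -(l_uniq j erefl) (l_uniq j').
Qed.

(** Both windows lie in the class of the window at [i], so each equals the unique representative [y]
    of that class, which has a single position. *)
Lemma quotient_window_inj (d k : nat) (P : seq bool) (Q : seq (Zmod d))
    (i i' : 'I_(size Q)) (c : Zmod d) :
  quotient_string k P Q ->
  {in comb_indices P, forall p, cyc Q (i + p) - cyc Q (i' + p) = c} -> i = i'.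
Proof.
move=> [combP _ quotPQ] diff_c.
pose x := Tuple (size_window Q i combP); pose z := Tuple (size_window Q i' combP).
have [y [_ y_uniq] [l [_ l_uniq]]] := quotPQ x.
have yx : y = x.
  by apply: y_uniq; split; [exists 0 => q; rewrite subrr | exists i].
have yz : y = z.
  apply: y_uniq; split; last by exists i'.
  exists c => q; rewrite !(tnth_nth 0) /=.
  have q_lt : (q < size (comb_indices P))%N by rewrite size_comb_indices combP.
  by rewrite !(nth_map 0%N) // diff_c // mem_nth.
by rewrite -(l_uniq i) ?yx // (l_uniq i') // yz.
Qed.

Lemma connect_const (T : finType) (e : rel T) (A : Type) (h : T -> A) :
  (forall x y, e x y -> h x = h y) -> forall x y, connect e x y -> h x = h y.
Proof.
move=> he x y /connectP[p]; elim: p x => [x _ -> //|z p IHp x /= /andP[exz pz] ly].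
by rewrite (he _ _ exz); apply: IHp.
Qed.

Lemma mem_comb_indices_enum (m : nat) (a : pred 'I_m) (p : 'I_m) :
  (nat_of_ord p \in comb_indices [seq a u | u <- enum 'I_m]) = a p.
Proof.
rewrite mem_filter mem_iota size_map size_enum_ord ltn_ord andbT.
by rewrite (nth_map p) ?size_enum_ord // nth_ord_enum andbT.
Qed.

Lemma comb_indices_enumP (m : nat) (a : pred 'I_m) (p : nat) :
  p \in comb_indices [seq a u | u <- enum 'I_m] -> exists2 u : 'I_m, a u & p = u.
Proof.
move=> p_in; have := p_in; rewrite mem_filter mem_iota size_map size_enum_ord.
case/and3P=> _ _ p_lt; exists (Ordinal p_lt) => //.
by rewrite -(mem_comb_indices_enum a (Ordinal p_lt)).
Qed.

Section Blocks.
Variables (s t : nat) (B : {set 'I_s * 'I_t}).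

(** With its vertical analogue, this carries a property checked on every block over to every entry
    of a comb window. *)
Lemma comb_indices_hprojP (p : nat) :
  p \in comb_indices (hproj B) <-> exists b : block B, p = bcol b.
Proof.
split=> [/comb_indices_enumP[v /existsP[u uvB] ->]|[[[u v] uvB] ->]].
  by exists (exist _ (u, v) uvB).
by rewrite mem_comb_indices_enum; apply/existsP; exists u.
Qed.

Lemma comb_indices_vprojP (p : nat) :
  p \in comb_indices (vproj B) <-> exists b : block B, p = brow b.
Proof.
split=> [/comb_indices_enumP[u /existsP[v uvB] ->]|[[[u v] uvB] ->]].
  by exists (exist _ (u, v) uvB).
by rewrite mem_comb_indices_enum; apply/existsP; exists v.
Qed.

Lemma connection_graph_line (b c : block B) :
  connection_graph b c -> brow b = brow c \/ bcol b = bcol c.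
Proof. by case/or4P=> /and3P[/eqP ? _ _]; auto. Qed.

(** Here [x] and [y] stand for differences of entries of [S] and of [Q] between two positions. An
    edge within a column keeps the argument of [x]; an edge within a row keeps that of [y], hence
    the value of [x]. *)
Lemma separable_const (G : zmodType) (x y : nat -> G) :
  (forall b c : block B, connect (connection_graph (B := B)) b c) ->
  (forall b : block B, x (bcol b) = y (brow b)) ->
  forall b c : block B, x (bcol b) = x (bcol c).
Proof.
move=> connB xy b c; apply: (connect_const (h := x \o @bcol s t B)) (connB b c).
by move=> {}b {}c /connection_graph_line[] /= eq_bc; [rewrite !xy eq_bc | rewrite eq_bc].
Qed.

End Blocks.

Theorem theorem3p9 (d n k s t : nat) (d_gt0 : (0 < d)%N)
    (P1 P2 : seq bool) (S Q : seq (Zmod d)) (B : {set 'I_s * 'I_t}) :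
  de_bruijn n P1 S ->
  quotient_string k P2 Q ->
  #|B| = (n + k - 1)%N ->
  is_tree (connection_graph (B := B)) ->
  hproj B = P1 ->
  vproj B = P2 ->
  forall f : block B -> Zmod d,
    exists! ij : 'I_(size Q) * 'I_(size S),
      filling_appears_at Q S f ij.1 ij.2.
Proof.
move=> dbS quQ cardB [/card_gt0P[b0 _] connB _] hB vB f.
pose fill (ij : 'I_(size Q) * 'I_(size S)) : {ffun block B -> Zmod d} :=
  [ffun b => grid Q S (ij.1 + brow b) (ij.2 + bcol b)].
have fill_inj : injective fill.
  move=> [i j] [i' j'] /ffunP eq_fill.
  (* The two positions are swapped in [y], so that equal grid entries at [b] give
     [x (bcol b) = y (brow b)] without a sign. *)
  pose x p := cyc S (j + p) - cyc S (j' + p).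
  pose y p := cyc Q (i' + p) - cyc Q (i + p).
  have xy (b : block B) : x (bcol b) = y (brow b).
    have := eq_fill b; rewrite !ffunE /grid /= => eq_b.
    by apply/eqP; rewrite subr_eq addrAC eq_sym subr_eq eq_b addrC.
  have x_const := separable_const connB xy.
  have eq_i : i = i'.
    (* The difference from [i] to [i'] is the opposite of [y], and [y] equals [x (bcol b0)] on every
       occupied row. *)
    apply: (quotient_window_inj (c := - x (bcol b0)) quQ) => p.
    rewrite -vB => /comb_indices_vprojP[b ->].
    by rewrite (x_const b0 b) xy opprB.
  have x0 (b : block B) : x (bcol b) = 0 by rewrite xy /y eq_i subrr.
  rewrite eq_i; congr pair; apply: (de_bruijn_window_inj dbS).
  apply/eq_in_map => p; rewrite -hB => /comb_indices_hprojP[b ->].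
  by apply/eqP; rewrite -subr_eq0; apply/eqP/x0.
(* The block [b0] puts a one in [P2]. With [k] positive, the truncated subtractions satisfy
   [n + (k - 1) = n + k - 1] in the count below. *)
have k_gt0 : (0 < k)%N.
  case: quQ => <- _ _; rewrite -size_comb_indices -vB.
  have: brow b0 \in comb_indices (vproj B) by apply/comb_indices_vprojP; exists b0.
  by case: (comb_indices _).
have card_fill :
    #|{ffun block B -> Zmod d}| = #|{: 'I_(size Q) * 'I_(size S)}|.
  transitivity (d ^ (n + k - 1))%N.
    by rewrite card_ffun card_ord card_sig prednK // -cardB.
  rewrite card_prod !card_ord; case: dbS quQ => [_ -> _] [_ -> _].
  by rewrite -expnD [in RHS]addnC addnBA.
(* An injection between finite sets of equal size is bijective: [fillK] yields existence of the
   position and [posK] its uniqueness. *)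
have [pos posK fillK] := inj_card_bij fill_inj (eq_leq card_fill).
exists (pos (finfun f)); split=> [b|ij ij_f].
  by have /ffunP/(_ b) := fillK (finfun f); rewrite !ffunE.
by rewrite -[RHS]posK; congr pos; apply/ffunP=> b; rewrite !ffunE ij_f.
Qed.
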